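(* Let $S_m$ be the bidirected star with center $c$ and leaves $L=\{\ell_1,\dots,\ell_m\}$, where the edges $(\ell_i,c)$ have weights $a_i>0$ and the edges $(c,\ell_i)$ have weights $b_i>0$. Let $S\subseteq L$ be a nonempty set of leaves, and assume that $c$ is not initially blue. Then $$\operatorname{ept}_{\mathrm{rzf}}(S_m,S)=1+\frac{\sum_{i=1}^m a_i}{\sum_{\ell_i\in S}a_i}.$$ In particular, for a single leaf $\ell_j$, $$\operatorname{ept}_{\mathrm{rzf}}(S_m,\{\ell_j\})=1+\frac{\sum_{i=1}^m a_i}{a_j}.$$
   Context: The only edges of $S_m$ are the directed edges $(\ell_i,c)$ and $(c,\ell_i)$, $1\le i\le m$. Randomized zero forcing (RZF): $G$ is a finite directed graph with nonnegative weights $w_{uv}$ on directed edges $(u,v)$, with $w_{uv}=0$ if there is no edge from $u$ to $v$. Start with blue set $B_0=S$. Given the blue set $B_t$, each white vertex $w\notin B_t$ independently becomes blue at round $t+1$ with probability $p_t(w)=\frac{\sum_{u\in B_t}w_{uw}}{\sum_{u\in V(G)}w_{uw}}$ if the denominator is positive, and $p_t(w)=0$ otherwise; blue vertices stay blue forever. Expected propagation time: if it is possible to color all of $G$ blue starting from the initial blue set $S$, then $\operatorname{ept}_{\mathrm{rzf}}(G,S)$ is the expected value of $\tau=\min\{t: B_t=V(G)\}$; otherwise it is $\infty$.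
   Formalization: The formal theorem requires S to be a nonempty proper subset of the leaves L, and m > 1 in the single-leaf part; for S = L the claim is false, since the center turns blue at round 1 with probability 1, so ept = 1 while the formula gives 2. *)

(* Defs.v *)
From HB Require Import structures.
From mathcomp Require Import all_boot all_order all_algebra.
From mathcomp Require Import all_classical all_reals all_analysis.
From mathcomp Require Import lra.

Set Implicit Arguments.
Unset Strict Implicit.
Unset Printing Implicit Defensive.

Import Order.TTheory GRing.Theory Num.Theory.
Import numFieldNormedType.Exports.

Local Open Scope classical_set_scope.
Local Open Scope ring_scope.

Record wdigraph (R : realType) (V : finType) := WDigraph {
  edge : rel V;
  weight : V -> V -> R;
  weight_ge0 : forall u v, 0 <= weight u v;
  weight_nonedge : forall u v, ~~ edge u v -> weight u v = 0 }.

Section RZF.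
Context {R : realType} {V : finType}.
Implicit Types (G : wdigraph R V) (A S : {set V}).

Definition in_weight G (v : V) : R := \sum_u weight G u v.

(* Probability that v is blue one round after the blue set is A; blue vertices
   stay blue. *)
Definition blue_prob G A (v : V) : R :=
  if v \in A then 1
  else if 0 < in_weight G v then (\sum_(u in A) weight G u v) / in_weight G v
  else 0.

(* One-round transition probability from A to A'. The product over the vertices
   expresses that they are coloured independently of each other. *)
Definition rzf_trans G A A' : R :=
  \prod_v (if v \in A' then blue_prob G A v else 1 - blue_prob G A v).

(* B is randomized zero forcing on G started at S: given the whole history
   B_0, ..., B_t, the law of B_{t+1} is rzf_trans G B_t. Multiplying by the
   probability of the history avoids conditioning on null events. *)
Definition rzf_process G S d (T : measurableType d) (P : probability T R)
    (B : nat -> T -> {set V}) : Prop :=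
  [/\ forall t A, measurable [set x | B t x = A],
      forall x, B 0 x = S &
      forall (t : nat) (h : nat -> {set V}) A,
        P ([set x | forall i, (i <= t)%N -> B i x = h i] `&`
           [set x | B t.+1 x = A]) =
        (P [set x | forall i, (i <= t)%N -> B i x = h i] *
         (rzf_trans G (h t) A)%:E)%E].

(* The first round at which the whole graph is blue, +oo if there is none. *)
Definition prop_time (T : Type) (B : nat -> T -> {set V}) (x : T) : \bar R :=
  ereal_inf [set t%:R%:E | t in [set t : nat | B t x = [set: V]%SET]].

(* [set: V] can be reached from S by rounds of positive probability. *)
Definition can_color_all G S : bool :=
  connect (fun A A' => 0 < rzf_trans G A A') S [set: V]%SET.

(* Expected propagation time, computed on a realization B of the process. *)
Definition ept_rzf G S d (T : measurableType d) (P : probability T R)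
    (B : nat -> T -> {set V}) : \bar R :=
  if can_color_all G S then (\int[P]_x prop_time B x)%E else +oo%E.

End RZF.

Section Star.
Context {R : realType} (m : nat).

Definition star_center : option 'I_m := None.
Definition star_leaf (i : 'I_m) : option 'I_m := Some i.
Definition star_leaves : {set option 'I_m} := [set star_leaf i | i : 'I_m]%SET.

Definition star_edge (u v : option 'I_m) : bool :=
  match u, v with
  | Some _, None | None, Some _ => true
  | _, _ => false
  end.

Definition star_weight (a b : 'I_m -> R) (u v : option 'I_m) : R :=
  match u, v with
  | Some i, None => a i
  | None, Some i => b i
  | _, _ => 0
  end.

Lemma star_weight_ge0 a b (a_gt0 : forall i, 0 < a i) (b_gt0 : forall i, 0 < b i)
  u v : 0 <= star_weight a b u v.
Proof. by case: u v => [i|] [j|] //=; apply: ltW. Qed.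

Lemma star_weight_nonedge a b u v : ~~ star_edge u v -> star_weight a b u v = 0.
Proof. by case: u v => [i|] [j|]. Qed.

Definition star (a b : 'I_m -> R)
    (a_gt0 : forall i, 0 < a i) (b_gt0 : forall i, 0 < b i) :
    wdigraph R (option 'I_m) :=
  WDigraph (star_weight_ge0 a_gt0 b_gt0) (@star_weight_nonedge a b).

End Star.

(* rzf_process is realizable for every weighted digraph and every initial set
   (lemma rzf_process_exists). The probability space is [0, 1[ with the uniform
   measure: the current residual u in [0, 1[ selects the next blue set A' by the
   cumulative sums F of the transition probabilities, and is then rescaled from
   [F, F + rzf_trans A A'[ to [0, 1[. *)
Module RzfRealization.

Section U.
Context {R : realType}.
Definition U01 := mrestr (@lebesgue_measure R) (measurable_itv `[0%R, 1%R[).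
HB.instance Definition _ := Measure.on U01.
Lemma U01T : U01 setT = 1%E.
Proof. rewrite /U01 /mrestr setTI /= lebesgue_measure_itv /= lte_fin ltr01 -EFinD subr0 //. Qed.
HB.instance Definition _ := @Measure_isProbability.Build _ _ R U01 U01T.
End U.

Section E.
Context {R : realType} {V : finType} (G : wdigraph R V) (S : {set V}).
Local Notation K := (rzf_trans G).

Lemma bp A v : 0 <= blue_prob G A v <= 1.
Proof.
rewrite /blue_prob; case: ifP => _; first by rewrite ler01 lexx.
case: ifP => [h|_]; last by rewrite lexx ler01.
rewrite divr_ge0 ?(ltW h) //= ?sumr_ge0 //; last by move=> *; exact: weight_ge0.
rewrite ler_pdivrMr // mul1r /in_weight [leRHS](bigID [in A]) /= lerDl.
by apply: sumr_ge0 => *; exact: weight_ge0.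
Qed.

Lemma K0 A A' : 0 <= K A A'.
Proof. apply: prodr_ge0 => v _; have := bp A v; case: ifP => _ /andP[]; lra. Qed.

Lemma K1 A : \sum_A' K A A' = 1.
Proof.
have E := @bigA_distr_bigA R 0 1 *%R +%R V bool
   (fun v c => if c then blue_prob G A v else 1 - blue_prob G A v).
rewrite [LHS]big1 in E; last first.
  by move=> v _; rewrite (bigD1 true) //= (big_pred1 false) ?subrKC // => -[].
rewrite E; rewrite (reindex (fun f : {ffun V -> bool} => [set v | f v]%SET)) /=.
  by apply: eq_bigr => f _; apply: eq_bigr => v _; rewrite inE.
exists (fun A0 : {set V} => [ffun v => v \in A0]) => x _.
  by apply/ffunP => v; rewrite ffunE inE.
by apply/setP => v; rewrite inE ffunE.
Qed.

Definition C A n := \sum_(A' : {set V} | (enum_rank A' < n)%N) K A A'.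
Definition F A (A' : {set V}) := C A (enum_rank A').

Lemma CS A A' : C A (enum_rank A').+1 = F A A' + K A A'.
Proof.
rewrite /F /C (bigD1 A') /= ?ltnSn // addrC; congr (_ + _).
apply: eq_bigl => x; rewrite ltnS ltn_neqAle andbC; congr (_ && _).
by congr (~~ _); apply/eqP/eqP => [->//|/val_inj/enum_rank_inj].
Qed.

Lemma C_homo A m n : (m <= n)%N -> C A m <= C A n.
Proof.
move=> mn; rewrite /C [leRHS](bigID (fun A' : {set V} => (enum_rank A' < m)%N)) /=.
rewrite [X in _ <= X + _](eq_bigl (fun A' : {set V} => (enum_rank A' < m)%N)).
  by rewrite lerDl sumr_ge0 // => *; exact: K0.
by move=> x; apply: andb_idl => h; apply: leq_trans h mn.
Qed.

Lemma CT A : C A #|{set V}| = 1.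
Proof. by rewrite /C -[RHS](K1 A); apply: eq_bigl => x; rewrite ltn_ord. Qed.

Lemma F0 A A' : 0 <= F A A'.
Proof. by apply: sumr_ge0 => *; exact: K0. Qed.
Lemma FK1 A A' : F A A' + K A A' <= 1.
Proof. by rewrite -CS -(CT A) C_homo // ltn_ord. Qed.

Lemma cover A u : 0 <= u < 1 -> exists A', F A A' <= u < F A A' + K A A'.
Proof.
move=> /andP[u0 u1].
have ex : exists n, u < C A n by exists #|{set V}|; rewrite CT.
case: (ex_minnP ex) => -[|n]; first by rewrite /C big_pred0 // ltNge u0.
move=> h hm.
have nlt : (n < #|{set V}|)%N by apply: (hm #|{set V}|); rewrite CT.
exists (enum_val (Ordinal nlt)); rewrite -CS /F enum_valK /= h andbT leNgt.
by apply/negP => /hm; rewrite ltnn.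
Qed.

Lemma uniqF A A1 A2 u : F A A1 <= u < F A A1 + K A A1 ->
  F A A2 <= u < F A A2 + K A A2 -> A1 = A2.
Proof.
rewrite -!CS /F => /andP[a1 b1] /andP[a2 b2].
apply: enum_rank_inj; apply: val_inj; apply/eqP.
rewrite eqn_leq; apply/andP; split; rewrite leqNgt; apply/negP => h;
 have := C_homo A h; lra.
Qed.

Definition step (su : {set V} * R) : {set V} * R :=
  match [pick A' | F su.1 A' <= su.2 < F su.1 A' + K su.1 A'] with
  | Some A' => (A', (su.2 - F su.1 A') / K su.1 A')
  | None => (su.1, -1) end.
Definition X t x := iter t step (S, x).

Lemma stepE A u A' c : 0 <= c <= 1 ->
  ((step (A, u)).1 = A' /\ 0 <= (step (A, u)).2 < c) <->
  (F A A' <= u < F A A' + K A A' * c).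
Proof.
move=> /andP[c0 c1]; rewrite /step /=; case: pickP => [A2 /= h|h] /=.
  have K2 : 0 < K A A2 by lra.
  rewrite ler_pdivlMr // mul0r ltr_pdivrMr //; split => [[<-]|h']; first lra.
  have e : A' = A2.
    by apply: (@uniqF A A' A2 u) h; have := ler_piMr (K0 A A') c1; lra.
  by rewrite e in h' *; split=> //; lra.
split; first by move=> [_]; lra.
by move=> h'; have := h A'; have := ler_piMr (K0 A A') c1; lra.
Qed.

Definition p (h : nat -> {set V}) t : R :=
  (h 0%N == S)%:R * \prod_(i < t) K (h i) (h i.+1).

Lemma main (h : nat -> {set V}) t : exists a, [/\ 0 <= a, a + p h t <= 1, 0 <= p h t &
  forall c x, 0 <= c <= 1 ->
   ((forall i, (i <= t)%N -> (X i x).1 = h i) /\ 0 <= (X t x).2 < c) <->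
   (a <= x < a + p h t * c)].
Proof.
elim: t => [|t [a [a0 a1 p0 ih]]].
  exists 0; rewrite /p big_ord0 mulr1 add0r; split=> //; first by case: (_ == _).
  move=> c x c01; rewrite add0r /X /=; case: eqP => e /=.
    rewrite mul1r; split => [[] //|hx]; split => // -[] // _; exact/esym.
  rewrite mul0r; split; last lra.
  by move=> [/(_ 0%N isT)/esym].
have pS : p h t.+1 = p h t * K (h t) (h t.+1) by rewrite /p big_ord_recr /= mulrA.
have f0 := F0 (h t) (h t.+1); have f1 := FK1 (h t) (h t.+1); have k0 := K0 (h t) (h t.+1).
exists (a + p h t * F (h t) (h t.+1)); rewrite pS; split; [nra|nra|nra|].
move=> c x c01.
have c01' := c01; move/andP: c01' => [c0 c1].
set f := F _ _ in f0 f1 *; set k := K _ _ in k0 f1 *.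
have kc : k * c <= k by rewrite ler_piMr.
have kc0 : 0 <= k * c by apply: mulr_ge0.
have i1 := ih (f + k * c) x; have i2 := ih f x.
have {}i1 := i1 ltac:(lra). have {}i2 := i2 ltac:(lra).
have XS : X t.+1 x = step ((X t x).1, (X t x).2) by rewrite /X iterS -surjective_pairing.
transitivity ((forall i, (i <= t)%N -> (X i x).1 = h i) /\ f <= (X t x).2 < f + k * c).
  split=> [[H1]|[H1 H2]].
    rewrite XS => H2; split; first by move=> i it; apply: H1; exact: leqW.
    have e : (X t x).1 = h t by apply: H1.
    rewrite /f /k -e; apply/stepE => //; split => //.
    by rewrite -XS H1.
  have e : (X t x).1 = h t by apply: H1.
  rewrite XS; move: H2; rewrite /f /k -e => /(stepE (X t x).1 (X t x).2 (h t.+1) c01) [e1 e2].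
  split=> // i; rewrite leq_eqVlt => /orP[/eqP ->|]; last by rewrite ltnS; exact: H1.
  by rewrite XS.
split=> [[H1 /andP[H2 H3]]|H].
  have u0 : 0 <= (X t x).2 by lra.
  have /i1 : (forall i, (i <= t)%N -> (X i x).1 = h i) /\ 0 <= (X t x).2 < f + k * c.
    by split=> //; rewrite u0.
  have n2 : ~ (a <= x < a + p h t * f) by move=> /i2 [_]; lra.
  move=> /andP[h1 h2]; apply/andP; split; last by rewrite -mulrA -addrA -mulrDr.
  by rewrite leNgt; apply/negP => h3; apply: n2; rewrite h1.
have /i1 [H1 /andP[H2 H3]] : a <= x < a + p h t * (f + k * c).
  have : 0 <= p h t * f by apply: mulr_ge0.
  rewrite -mulrA in H; rewrite mulrDr addrA; lra.
split=> //; rewrite H3 andbT leNgt; apply/negP => H4.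
have /i2 : (forall i, (i <= t)%N -> (X i x).1 = h i) /\ 0 <= (X t x).2 < f.
  by rewrite H2.
by lra.
Qed.

Lemma inside t x : 0 <= x < 1 -> 0 <= (X t x).2 < 1.
Proof.
move=> x01; elim: t => // t ih.
have [A' h] := cover (X t x).1 ih.
have : F (X t x).1 A' <= (X t x).2 < F (X t x).1 A' + K (X t x).1 A' * 1 by rewrite mulr1.
by move=> /stepE []; rewrite ?ler01 ?lexx // -surjective_pairing /X iterS.
Qed.

Lemma outside t x : ~~ (0 <= x < 1) -> (X t x).1 = S /\ ~~ (0 <= (X t x).2 < 1).
Proof.
move=> x01; elim: t => // t [ih1 ih2].
rewrite /X iterS -/(X t x) /step; case: pickP => [A' h|h] /=; last by split=> //; lra.
exfalso; move/negP: ih2; apply.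
by have := F0 (X t x).1 A'; have := FK1 (X t x).1 A'; lra.
Qed.

Lemma hist h t : exists a, [/\ 0 <= a, 0 <= p h t, a + p h t <= 1 &
  [set x | forall i, (i <= t)%N -> (X i x).1 = h i] `&` `[0, 1[ = `[a, a + p h t[%classic].
Proof.
have [a [a0 a1 p0 H]] := main h t; exists a; split=> //.
apply/seteqP; split=> x /=; rewrite !in_itv /=.
  move=> [h1 h2]; rewrite -[p h t]mulr1; apply/(H 1); rewrite ?ler01 ?lexx //.
  by split=> //; exact: inside.
move=> hx; have : a <= x < a + p h t * 1 by rewrite mulr1.
by move=> /H [|h1 h2]; rewrite ?ler01 ?lexx //; split=> //; lra.
Qed.

Lemma Phist h t : U01 [set x | forall i, (i <= t)%N -> (X i x).1 = h i] = (p h t)%:E.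
Proof.
have [a [a0 p0 a1 e]] := hist h t.
rewrite /U01 /mrestr e /= lebesgue_measure_itv /= lte_fin ltrDl.
case: ltP => h0; first by rewrite -EFinD addrC addKr.
by congr (_%:E); lra.
Qed.

Lemma rzf_process_exists : exists (d : measure_display) (T : measurableType d) (P : probability T R)
  (B : nat -> T -> {set V}), rzf_process G S P B.
Proof.
exists _, (measurableTypeR R), (U01 : probability _ _), (fun t x => (X t x).1); split => //.
- move=> t A.
  have -> : [set x | (X t x).1 = A] =
   (\bigcup_(h in [set: {ffun 'I_t.+1 -> {set V}}])
     if h ord_max == A then
     [set x | forall i, (i <= t)%N -> (X i x).1 = h (inord i)] `&` `[0, 1[ else set0) `|`
   (if S == A then ~` `[0, 1[ else set0).
    apply/seteqP; split=> x /=.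
      move=> hA; case: (boolP (0 <= x < 1)) => h01.
        left; exists [ffun i : 'I_t.+1 => (X i x).1] => //.
        rewrite ffunE hA eqxx /= in_itv /=; split => // i it.
        by rewrite ffunE inordK.
      by right; have [<- _] := outside t h01; rewrite hA eqxx /= in_itv; exact/negP.
    move=> [[h _]|]; case: eqP => // <-.
      by move=> [/(_ t (leqnn _)) -> _]; congr (h _); apply: val_inj; rewrite /= inordK.
    by rewrite /= in_itv => /negP /(outside t) [].
  apply: measurableU.
    apply: fin_bigcup_measurable => // h _; case: ifP => // _.
    have [a [_ _ _ ->]] := hist (fun i => h (inord i)) t; exact: measurable_itv.
  by case: ifP => // _; apply: measurableC; exact: measurable_itv.
- move=> t h A.
  pose h' i := if (i <= t)%N then h i else A.
  rewrite (_ : _ `&` _ = [set x | forall i, (i <= t.+1)%N -> (X i x).1 = h' i]); last first.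
    apply/seteqP; split=> x /=.
      move=> [h1 h2] i; rewrite /h' leq_eqVlt ltnS => /orP[/eqP ->|it].
        by rewrite ltnn.
      by rewrite it h1.
    move=> H; split; last by have := H t.+1 (leqnn _); rewrite /h' ltnn.
    by move=> i it; have := H i (leqW it); rewrite /h' it.
  apply: (etrans (Phist h' t.+1)); apply: esym.
  apply: (etrans (congr1 (fun z => z * _)%E (Phist h t))); apply: esym.
  rewrite -EFinM; congr (_%:E); have e1 : h' t = h t by rewrite /h' leqnn.
  have e2 : h' t.+1 = A by rewrite /h' ltnn.
  have e0 : h' 0 = h 0 by [].
  rewrite /p big_ord_recr /= mulrA e1 e2 e0.
  congr (_ * _ * _); apply: eq_bigr => i _.
  by rewrite /h' (ltnW (ltn_ord i)) ltn_ord.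
Qed.
End E.

End RzfRealization.

(* Main.v *)
Require Import Defs.
From mathcomp Require Import all_boot all_order all_algebra.
From mathcomp Require Import all_classical all_reals all_analysis.
From mathcomp Require Import measurable_realfun lra.

Import Order.TTheory GRing.Theory Num.Theory.
Import numFieldNormedType.Exports.

Local Open Scope ring_scope.

(** Write [q] for the fraction of the weight into the centre that comes from
    [S]. A leaf outside [S] can only be forced by the centre, so the process
    stays at [S] with probability [1 - q], moves to [S] plus the centre with
    probability [q], and is then all blue one round later. Hence
    [P (tau > t + 1) = (1 - q) ^ t], and the expectation is the sum of the tails
    [1 + \sum_t (1 - q) ^ t = 1 + 1 / q]. *)

Lemma big_option (A : Type) (idx : A) (op : Monoid.com_law idx) (I : finType)
    (f : option I -> A) :
  \big[op/idx]_v f v = op (f None) (\big[op/idx]_i f (Some i)).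
Proof.
rewrite (bigD1 None) //= (reindex_omap (@Some I) id) => [|[i|] //].
by congr (op _ _); apply: eq_bigl => i; rewrite eqxx.
Qed.

(** * Propagation time as a series of tail probabilities, for any weighted digraph *)

Section PropagationTime.
Local Open Scope classical_set_scope.
Context {R : realType} {V : finType}.

(** This is the event [tau > t]. All rounds up to [t] are tested, since [rzf_process] constrains
    only probabilities and does not make [B] monotone at every point. *)
Definition not_all_blue {T : Type} (B : nat -> T -> {set V}) (t : nat) : set T :=
  [set x | forall s, (s <= t)%N -> B s x <> [set: V]%SET].

(** An extended natural number counts the naturals below it; this holds pointwise, also where [tau]
    is infinite. *)
Lemma prop_time_nneseries (T : Type) (B : nat -> T -> {set V}) (x : T) :
  prop_time B x = (\sum_(0 <= t <oo) (\1_(not_all_blue B t) x : R)%:E)%E.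
Proof.
have ind_ge0 t : (0 <= (\1_(not_all_blue B t) x : R)%:E)%E.
  by rewrite lee_fin indicE.
have [ex|nex] := pselect (exists t, B t x == [set: V]%SET); last first.
  have nex' t : B t x <> [set: V]%SET by move=> e; apply: nex; exists t; rewrite e.
  have -> : prop_time (R := R) B x = +oo%E.
    rewrite /prop_time (_ : [set t | _] = set0) ?image_set0 ?ereal_inf0 //.
    by apply/seteqP; split=> t //= /nex'.
  apply/esym/eqyP => A A0.
  (* Every indicator is 1 here, so the partial sum of the first [k] terms is [k], which exceeds
     [A]. *)
  pose k := Num.bound `|A|.
  apply: (le_trans _ (nneseries_lim_ge k (fun t _ _ => ind_ge0 t))).
  rewrite sumEFin (eq_bigr (fun=> 1)) => [|t _]; last first.
    by rewrite indicE mem_set //= => s _.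
  rewrite big_const_nat subn0 iter_addr_0 lee_fin ltW //.
  exact: le_lt_trans (ler_norm A) (archi_boundP (normr_ge0 _)).
have := ex_minnP ex => -[n /eqP Bn n_min].
have -> : prop_time (R := R) B x = n%:R%:E.
  apply/eqP; rewrite eq_le; apply/andP; split.
    by apply: ereal_inf_lbound; exists n.
  apply: le_ereal_inf_tmp => _ [t /= Bt <-].
  by rewrite lee_fin ler_nat n_min // Bt.
(* Indices below the first all-blue round [n] contribute 1 each, the later ones 0. *)
rewrite (nneseries_split 0 n) // add0n eseries0 ?adde0 => [|t nt _]; last first.
  by rewrite indicE memNset // => /(_ n nt).
rewrite sumEFin big_nat_cond (eq_bigr (fun=> 1)) => [|t /andP[/andP[_ tn] _]].
  by rewrite -big_nat_cond big_const_nat subn0 iter_addr_0.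
rewrite indicE mem_set //= => s st Bs.
by have := n_min s; rewrite Bs eqxx leqNgt (leq_ltn_trans st tn) => /(_ isT).
Qed.

Context {G : wdigraph R V} {S : {set V}} {d : measure_display}
  {T : measurableType d} {P : probability T R} {B : nat -> T -> {set V}}.
Hypothesis BP : rzf_process G S P B.

Lemma measurable_not_all_blue t : measurable (not_all_blue B t).
Proof.
have [mB _ _] := BP.
rewrite (_ : not_all_blue B t =
  \bigcap_(s in [set s | (s <= t)%N]) ~` [set x | B s x = [set: V]%SET]) //.
by apply: bigcap_measurable => [|s _]; [exists 0%N|exact: measurableC].
Qed.

Lemma measurable_history t (h : nat -> {set V}) :
  measurable [set x | forall i, (i <= t)%N -> B i x = h i].
Proof.
have [mB _ _] := BP.
rewrite (_ : [set x | _] =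
  \bigcap_(s in [set s | (s <= t)%N]) [set x | B s x = h s]) //.
by apply: bigcap_measurable => [|s _]; [exists 0%N|].
Qed.

Lemma integral_prop_time :
  (\int[P]_x prop_time B x = \sum_(0 <= t <oo) P (not_all_blue B t))%E.
Proof.
under eq_integral do rewrite prop_time_nneseries.
rewrite integral_nneseries //.
- apply: eq_eseriesr => t _.
  by rewrite integral_indic ?setIT //; exact: measurable_not_all_blue.
- move=> t; apply/measurable_EFinP; apply: measurable_indic.
  exact: measurable_not_all_blue.
Qed.

(** Chain rule by induction on [t]; as [B 0] is [S] everywhere, the history at round 0 is the sure
    event. *)
Lemma rzf_history_prob (h : nat -> {set V}) t : h 0%N = S ->
  P [set x | forall i, (i <= t)%N -> B i x = h i] =
  (\prod_(i < t) rzf_trans G (h i) (h i.+1))%:E.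
Proof.
have [_ B0 BS] := BP.
move=> h0; elim: t => [|t IH].
  rewrite big_ord0 (_ : [set x | _] = setT) ?probability_setT //.
  by apply/seteqP; split=> x //= _ i; rewrite leqn0 => /eqP->; rewrite B0.
rewrite big_ord_recr /= EFinM -IH -BS; congr (P _).
apply/seteqP; split=> x /=.
  by move=> H; split=> [i it|]; apply: H => //; exact: leqW.
by move=> [H1 H2] i; rewrite leq_eqVlt ltnS => /orP[/eqP->|/H1].
Qed.

End PropagationTime.

(** * One-round transition probabilities of the star *)

Section StarTransitions.
Context {R : realType} {m : nat} {a b : 'I_m -> R}.
Context {a_gt0 : forall i, 0 < a i} {b_gt0 : forall i, 0 < b i}.
Let G := star a_gt0 b_gt0.
Let c := star_center m.

Lemma star_sum (f : option 'I_m -> R) (A : {set option 'I_m}) :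
  \sum_(v in A) f v =
  (if c \in A then f c else 0) + \sum_(i | star_leaf i \in A) f (star_leaf i).
Proof. by rewrite big_mkcond big_option -big_mkcond. Qed.

(** The centre is the only in-neighbour of a leaf, so the weight [b i] cancels and a leaf is forced
    with probability 0 or 1. *)
Lemma star_blue_prob_leaf (A : {set option 'I_m}) i :
  blue_prob G A (star_leaf i) = ((star_leaf i \in A) || (c \in A))%:R.
Proof.
have inw : in_weight G (star_leaf i) = b i.
  by rewrite /in_weight big_option /= big1 ?addr0.
rewrite /blue_prob; case: ifP => //= _.
rewrite inw b_gt0 star_sum /= [X in _ + X]big1 // addr0.
by case: ifP; rewrite ?mul0r // divff // gt_eqF.
Qed.

Lemma star_blue_prob_center (A : {set option 'I_m}) : c \notin A ->
  blue_prob G A c = (\sum_(i | star_leaf i \in A) a i) / \sum_i a i.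
Proof.
move=> cA; have inw : in_weight G c = \sum_i a i.
  by rewrite /in_weight big_option /= add0r.
rewrite /blue_prob (negPf cA) inw star_sum (negPf cA) add0r; case: ifP => // /negbT.
(* In the default branch of [blue_prob] the total weight is 0, and the quotient is then 0 too
   because [0^-1 = 0]. *)
rewrite -leNgt => s0; have -> : \sum_i a i = 0.
  by apply/eqP; rewrite eq_le s0 sumr_ge0 // => i _; exact: ltW.
by rewrite invr0 mulr0.
Qed.

Context {S : {set option 'I_m}} (cS : c \notin S).
Let q := (\sum_(i | star_leaf i \in S) a i) / \sum_i a i.

(** While the centre is white every leaf keeps its colour surely, so only the centre contributes a
    factor other than 1. *)
Lemma star_trans_stay : rzf_trans G S S = 1 - q.
Proof.
rewrite /rzf_trans big_option /= (negPf cS) star_blue_prob_center //.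
rewrite [X in _ * X]big1 ?mulr1 // => i _.
rewrite -/(star_leaf i) star_blue_prob_leaf (negPf cS) orbF.
by case: (_ \in S); rewrite ?subr0.
Qed.

Lemma star_trans_center : rzf_trans G S (c |: S)%SET = q.
Proof.
rewrite /rzf_trans big_option /= setU11 star_blue_prob_center //.
rewrite [X in _ * X]big1 ?mulr1 // => i _.
rewrite -/(star_leaf i) star_blue_prob_leaf (negPf cS) orbF in_setU1 /=.
by case: (_ \in S); rewrite ?subr0.
Qed.

Lemma star_trans_all : rzf_trans G (c |: S)%SET [set: option 'I_m]%SET = 1.
Proof.
rewrite /rzf_trans big_option /= finset.in_setT {1}/blue_prob setU11 mul1r.
rewrite big1 // => i _; rewrite finset.in_setT.
by rewrite -/(star_leaf i) star_blue_prob_leaf setU11 orbT.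
Qed.

Context (S0 : S != finset.set0) (SL : S \proper star_leaves m).

Lemma star_sum_initial_gt0 : 0 < \sum_(i | star_leaf i \in S) a i.
Proof.
have /set0Pn[[i|] iS] := S0; last by case/negP: cS.
rewrite (bigD1 i) //= ltr_pwDl // sumr_ge0 // => j _; exact: ltW.
Qed.

Lemma star_sum_gt0 : 0 < \sum_i a i.
Proof.
apply: lt_le_trans star_sum_initial_gt0 _.
rewrite [leRHS](bigID (fun i => star_leaf i \in S)) /= lerDl.
by rewrite sumr_ge0 // => j _; exact: ltW.
Qed.

Lemma star_center_prob_gt0 : 0 < q.
Proof. by rewrite divr_gt0 ?star_sum_initial_gt0 ?star_sum_gt0. Qed.

Lemma star_center_prob_le1 : q <= 1.
Proof.
rewrite ler_pdivrMr ?star_sum_gt0 // mul1r.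
rewrite [leRHS](bigID (fun i => star_leaf i \in S)) /= lerDl.
by rewrite sumr_ge0 // => j _; exact: ltW.
Qed.

(** The path goes from [S] through [S] plus the centre; this selects the integral branch of
    [ept_rzf]. *)
Lemma star_can_color_all : can_color_all G S.
Proof.
apply: (connect_trans (y := (c |: S)%SET)); apply: connect1.
  by rewrite star_trans_center star_center_prob_gt0.
by rewrite star_trans_all.
Qed.

Lemma star_initial_neqT : S <> [set: option 'I_m]%SET.
Proof. by move=> e; move: cS; rewrite e finset.in_setT. Qed.

(* Here the properness of [S] enters: from [S = L] a single round would do. *)
Lemma star_center_neqT : (c |: S)%SET <> [set: option 'I_m]%SET.
Proof.
move=> e; have /properP[_ [_ /imsetP[i _ ->] iS]] := SL.
have : star_leaf i \in (c |: S)%SET by rewrite e finset.in_setT.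
by rewrite in_setU1 (negPf iS).
Qed.

(** * Tail probabilities and the expectation on the star *)

Local Open Scope classical_set_scope.
Context {d : measure_display} {T : measurableType d} {P : probability T R}
  {B : nat -> T -> {set option 'I_m}}.
Hypothesis BP : rzf_process G S P B.

Let hist (h : nat -> {set option 'I_m}) t :=
  [set x | forall i, (i <= t)%N -> B i x = h i].
(** Model histories: in [to_center t] the centre turns blue at round [t + 1]; [to_all t] continues
    it to the all-blue set at round [t + 2]. *)
Let to_center t i := if (i <= t)%N then S else (c |: S)%SET.
Let to_all t i := if (i <= t.+1)%N then to_center t i else [set: option 'I_m]%SET.

Lemma star_prob_stay t : P (hist (fun=> S) t) = ((1 - q) ^+ t)%:E.
Proof.
rewrite (rzf_history_prob BP) //; congr EFin.
by rewrite (eq_bigr (fun=> 1 - q)) ?prodr_const ?card_ord // => i _; rewrite star_trans_stay.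
Qed.

Lemma star_prob_to_center t : P (hist (to_center t) t.+1) = ((1 - q) ^+ t * q)%:E.
Proof.
rewrite (rzf_history_prob BP) //; congr EFin; rewrite big_ord_recr /=.
rewrite {3 4}/to_center leqnn ltnn star_trans_center; congr (_ * _).
rewrite (eq_bigr (fun=> 1 - q)) ?prodr_const ?card_ord // => i _.
by rewrite /to_center (ltnW (ltn_ord i)) ltn_ord star_trans_stay.
Qed.

Lemma star_prob_to_all t : P (hist (to_all t) t.+2) = ((1 - q) ^+ t * q)%:E.
Proof.
rewrite -star_prob_to_center !(rzf_history_prob BP) //; congr EFin.
rewrite big_ord_recr /= {3 4}/to_all leqnn ltnn /to_center ltnn star_trans_all mulr1.
by apply: eq_bigr => i _; rewrite /to_all (ltnW (ltn_ord i)) ltn_ord.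
Qed.

(** Induction: the history [to_all t] lies in [tau > t + 1] but is disjoint from [tau > t + 2], so
    passing to the next tail loses at least its probability [(1 - q) ^+ t * q]. Other histories need
    not be shown null. *)
Lemma star_tail_le t : (P (not_all_blue B t.+1) <= ((1 - q) ^+ t)%:E)%E.
Proof.
have mN := measurable_not_all_blue BP.
have mH h t' : measurable (hist h t') := measurable_history BP t' h.
elim: t => [|t IH]; first by rewrite expr0 probability_le1.
suff : (P (not_all_blue B t.+2) + P (hist (to_all t) t.+2) <= ((1 - q) ^+ t)%:E)%E.
  rewrite star_prob_to_all -leeBrDr // => /le_trans; apply.
  by rewrite -EFinB lee_fin exprSr mulrBr mulr1.
apply: le_trans IH; rewrite -measureU //.
  apply: le_measure; rewrite ?inE //; first exact: measurableU.
  move=> x [Nx s st|Hx s st]; first by apply: Nx; exact: leqW.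
  rewrite (Hx _ (leqW st)) /to_all st /to_center.
  by case: ifP => _; [exact: star_initial_neqT|exact: star_center_neqT].
apply/seteqP; split=> x //= [/(_ t.+2 (leqnn _)) + /(_ t.+2 (leqnn _))].
by rewrite /to_all ltnn.
Qed.

(** Two disjoint histories avoid the all-blue set up to round [t + 1]: staying at [S], or gaining
    the centre exactly then. Their probabilities add up to [(1 - q) ^+ t]. *)
Lemma star_tail_ge t : (((1 - q) ^+ t)%:E <= P (not_all_blue B t.+1))%E.
Proof.
have mN := measurable_not_all_blue BP.
have mH h t' : measurable (hist h t') := measurable_history BP t' h.
have -> : ((1 - q) ^+ t)%:E = (P (hist (fun=> S) t.+1) + P (hist (to_center t) t.+1))%E.
  by rewrite star_prob_stay star_prob_to_center -EFinD exprSr mulrBr mulr1 subrK.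
rewrite -measureU //.
  apply: le_measure; rewrite ?inE //; first exact: measurableU.
  move=> x [Hx s st|Hx s st]; rewrite Hx //; first exact: star_initial_neqT.
  by rewrite /to_center; case: ifP => _; [exact: star_initial_neqT|exact: star_center_neqT].
apply/seteqP; split=> x //= [/(_ t.+1 (leqnn _)) + /(_ t.+1 (leqnn _))].
rewrite /to_center ltnn => -> e; move: cS; rewrite e setU11 //.
Qed.

Lemma star_ept : ept_rzf G S P B =
  (1 + (\sum_i a i) / (\sum_(i | star_leaf i \in S) a i))%:E.
Proof.
have [_ B0 _] := BP.
rewrite /ept_rzf star_can_color_all (integral_prop_time BP) nneseries_recl //.
(* The tail at 0 is the sure event and gives the leading 1. *)
have -> : not_all_blue B 0 = setT.
  apply/seteqP; split=> x // _ s; rewrite leqn0 => /eqP ->.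
  by rewrite B0; exact: star_initial_neqT.
rewrite probability_setT -nneseries_addn // EFinD; congr (_ + _)%E.
under eq_eseriesr => t _.
  rewrite addn1 (_ : P _ = ((1 - q) ^+ t)%:E); last first.
    by apply/eqP; rewrite eq_le star_tail_le star_tail_ge.
  over.
have q0 := star_center_prob_gt0; have q1 := star_center_prob_le1.
(* From [0 < q <= 1] the ratio lies in [0, 1), and the sum [1 / q] is the quotient of weights in the
   claim. *)
have cvg_q := @cvg_geometric_series R 1 (1 - q) ltac:(rewrite ger0_norm; lra).
rewrite -[RHS]/((_ / _)%:E) -invf_div -/q -div1r.
rewrite (_ : q = 1 - (1 - q)); last by lra.
rewrite -(cvg_lim _ cvg_q) // -EFin_lim; last by apply/cvg_ex; eexists; exact: cvg_q.
congr (limn _); apply/funext => n /=; rewrite sumEFin.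
by congr EFin; apply: eq_bigr => t _; rewrite /= mul1r; congr (_ ^+ _); lra.
Qed.

End StarTransitions.

Theorem theorem3p2 (R : realType) (m : nat) (a b : 'I_m -> R)
    (a_gt0 : forall i, 0 < a i) (b_gt0 : forall i, 0 < b i) :
  (forall (S : {set option 'I_m}), S != finset.set0 -> S \proper star_leaves m ->
     star_center m \notin S ->
   forall (d : measure_display) (T : measurableType d) (P : probability T R)
     (B : nat -> T -> {set option 'I_m}),
     rzf_process (star a_gt0 b_gt0) S P B ->
     ept_rzf (star a_gt0 b_gt0) S P B =
       (1 + (\sum_i a i) / (\sum_(i | star_leaf i \in S) a i))%:E) /\
  (forall (j : 'I_m), (1 < m)%N ->
   forall (d : measure_display) (T : measurableType d) (P : probability T R)
     (B : nat -> T -> {set option 'I_m}),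
     rzf_process (star a_gt0 b_gt0) [set star_leaf j]%SET P B ->
     ept_rzf (star a_gt0 b_gt0) [set star_leaf j]%SET P B =
       (1 + (\sum_i a i) / a j)%:E).
Proof.
split=> [S S0 SL cS d T P B BP|j m_gt1 d T P B BP]; first exact: star_ept.
have cS : star_center m \notin [set star_leaf j]%SET by rewrite finset.in_set1.
have S0 : [set star_leaf j]%SET != finset.set0 :> {set option 'I_m}.
  by apply/set0Pn; exists (star_leaf j); rewrite finset.in_set1.
(* By cardinality, [1 < m]. For [m = 1] the graph would be all blue as soon as the centre is. *)
have SL : [set star_leaf j]%SET \proper star_leaves m.
  by rewrite properEcard finset.sub1set imset_f //= cards1 card_imset ?card_ord //.
rewrite (star_ept cS S0 SL BP) [X in _ / X](big_pred1 j) // => i.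
by rewrite finset.in_set1.
Qed.
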